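(* Let $G<\widehat{\mathrm{Diff}}_{\mathrm{Id}}(\mathbb C^n,0)$ be a subgroup of formal diffeomorphisms tangent to the identity containing a dicritic diffeomorphism tangent to the identity with order $k$. The following statements are equivalent: (1) $G$ is abelian; (2) $G$ is nilpotent; (3) every nontrivial element of $G$ is tangent to the identity with order $k$.
   Context: $\widehat{\mathrm{Diff}}(\mathbb C^n,0)$ is the group (under composition) of formal diffeomorphisms of $\mathbb C^n$ fixing the origin, and $\widehat{\mathrm{Diff}}_{\mathrm{Id}}(\mathbb C^n,0)$ the subgroup of those with linear part $\mathrm{Id}$. $\hat f$ is tangent to the identity with order $k\ge1$ if $\hat f(z)=z+f_{k+1}(z)+f_{k+2}(z)+\cdots$ with $f_j$ a vector of homogeneous polynomials of degree $j$ and $f_{k+1}\neq0$. Such an $\hat f$ is dicritic if $f_{k+1}(z)=f(z)z$ for a (scalar) homogeneous polynomial $f$ of degree $k$. *)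

(* Defs.v *)
From HB Require Import structures.
From mathcomp Require Import all_boot all_order all_algebra.
From mathcomp Require Import mpoly.
From mathcomp Require Import boolp classical_sets reals.
From mathcomp Require Import complex.

Set Implicit Arguments.
Unset Strict Implicit.
Unset Printing Implicit Defensive.

Import GRing.Theory.

Local Open Scope ring_scope.

Section FormalMaps.
Variables (K : fieldType) (n : nat).

Definition fps := 'X_{1..n} -> K.

Definition formal_map := 'I_n -> fps.

Implicit Types (p q : {mpoly K[n]}) (s : fps) (f g h : formal_map).

Definition fps_trunc (d : nat) s : {mpoly K[n]} :=
  \sum_(m : 'X_{1..n < d.+1}) s m *: 'X_[m].

Definition fps_hpart (j : nat) s : {mpoly K[n]} := pihomog mdeg j (fps_trunc j s).

(* When g has no constant term, the coefficient of 'X_[m] in f (g z) involves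
   only the terms of degree at most mdeg m of f and g. *)
Definition formal_comp f g : formal_map := fun i m =>
  (fps_trunc (mdeg m) (f i) \mPo [tuple fps_trunc (mdeg m) (g j) | j < n])@_m.

Definition formal_id : formal_map := fun i m => (m == U_(i)%MM)%:R.

Definition fixes0 f : bool := [forall i, f i 0%MM == 0].

(* The matrix of the linear part of f. *)
Definition jac f : 'M[K]_n := \matrix_(i, j) f i U_(j)%MM.

Record fdiff := FDiff {
  fdiff_val :> 'I_n -> fps;
  fdiff_fixes0 : fixes0 fdiff_val;
  fdiff_jac : jac fdiff_val \in unitmx }.

Lemma fdiff_inj (x y : fdiff) : (forall i m, x i m = y i m) -> x = y.
Proof.
case: x y => [f f0 fJ] [g g0 gJ] /= E.
have {}E : f = g by apply/funext => i; apply/funext => m.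
by subst g; rewrite (bool_irrelevance f0 g0) (bool_irrelevance fJ gJ).
Qed.

HB.instance Definition _ := gen_eqMixin fdiff.
HB.instance Definition _ := gen_choiceMixin fdiff.

(* [low e p] : all terms of p have degree at least e. *)
Definition low e p := forall m, (mdeg m < e)%N -> p@_m = 0.
Definition eqd d p q := low d.+1 (p - q).
Definition approx d p s := forall m, (mdeg m <= d)%N -> p@_m = s m.

Lemma lowW e e' p : (e' <= e)%N -> low e p -> low e' p.
Proof. by move=> le_e H m lt_m; apply: H; apply: leq_trans le_e. Qed.

Lemma low0 e : low e 0.
Proof. by move=> m _; rewrite mcoeff0. Qed.

Lemma lowD e p q : low e p -> low e q -> low e (p + q).
Proof. by move=> Hp Hq m lt_m; rewrite mcoeffD Hp ?Hq ?addr0. Qed.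

Lemma lowN e p : low e p -> low e (- p).
Proof. by move=> Hp m lt_m; rewrite mcoeffN Hp ?oppr0. Qed.

Lemma lowB e p q : low e p -> low e q -> low e (p - q).
Proof. by move=> Hp Hq; apply: lowD => //; apply: lowN. Qed.

Lemma lowZ e c p : low e p -> low e (c *: p).
Proof. by move=> Hp m lt_m; rewrite mcoeffZ Hp ?mulr0. Qed.

Lemma low_sum e (I : eqType) (r : seq I) (P : pred I) (F : I -> {mpoly K[n]}) :
  (forall i, i \in r -> P i -> low e (F i)) -> low e (\sum_(i <- r | P i) F i).
Proof.
move=> H; rewrite big_seq_cond; apply: (big_ind (low e)).
- exact: low0.
- exact: lowD.
- by move=> i /andP[ir Pi]; apply: H.
Qed.

Lemma lowM e e' p q : low e p -> low e' q -> low (e + e') (p * q).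
Proof.
move=> Hp Hq m lt_m; rewrite mcoeffM big1 // => k /eqP Em.
have [lt1|ge1] := ltnP (mdeg k.1) e; first by rewrite Hp ?mul0r.
rewrite Hq ?mulr0 // -(ltn_add2l (mdeg k.1)) -mdegD -Em.
by apply: leq_trans lt_m _; rewrite leq_add2r.
Qed.

Lemma lowMr e p q : low e p -> low e (p * q).
Proof. by move=> Hp; rewrite -[e]addn0; apply: lowM. Qed.

Lemma lowMl e p q : low e q -> low e (p * q).
Proof. by move=> Hq; rewrite -[e]add0n; apply: lowM. Qed.

Lemma eqd_refl d p : eqd d p p.
Proof. by rewrite /eqd subrr; apply: low0. Qed.

Lemma eqd_sym d p q : eqd d p q -> eqd d q p.
Proof. by rewrite /eqd => H; rewrite -opprB; apply: lowN. Qed.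

Lemma eqd_trans d p q r : eqd d p q -> eqd d q r -> eqd d p r.
Proof. by move=> H H'; rewrite /eqd -(subrKA q); apply: lowD. Qed.

Lemma eqdP d p q : eqd d p q <-> forall m, (mdeg m <= d)%N -> p@_m = q@_m.
Proof.
split=> H m lt_m; first by apply/eqP; rewrite -subr_eq0 -mcoeffB H.
by rewrite mcoeffB H ?subrr.
Qed.

Lemma eqdM d p p' q q' : eqd d p p' -> eqd d q q' -> eqd d (p * q) (p' * q').
Proof.
move=> Hp Hq; rewrite /eqd -(subrKA (p' * q)) -mulrBl -mulrBr.
by apply: lowD; [apply: lowMr|apply: lowMl].
Qed.

Lemma eqdX d p p' k : eqd d p p' -> eqd d (p ^+ k) (p' ^+ k).
Proof.
move=> Hp; elim: k => [|k IHk]; first by rewrite !expr0; apply: eqd_refl.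
by rewrite !exprS; apply: eqdM.
Qed.

Lemma eqd_prod d (F F' : 'I_n -> {mpoly K[n]}) :
  (forall i, eqd d (F i) (F' i)) -> eqd d (\prod_i F i) (\prod_i F' i).
Proof.
move=> H; apply: (big_ind2 (eqd d)) => [||i _]; last exact: H.
- exact: eqd_refl.
- by move=> ????; apply: eqdM.
Qed.

Lemma approx_trunc d e s : (d <= e)%N -> approx d (fps_trunc e s) s.
Proof.
by move=> le_d m le_m; rewrite /fps_trunc mcoeff_mpoly // ltnS (leq_trans le_m).
Qed.

Lemma approx_eqd d p q s : approx d p s -> approx d q s -> eqd d p q.
Proof. by move=> Hp Hq; apply/eqdP => m le_m; rewrite Hp ?Hq. Qed.

Lemma eqd_approx d p q s : eqd d p q -> approx d q s -> approx d p s.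
Proof. by move=> /eqdP H Hq m le_m; rewrite H ?Hq. Qed.

Lemma approxW d e p s : (d <= e)%N -> approx e p s -> approx d p s.
Proof. by move=> le_d H m le_m; rewrite H // (leq_trans le_m). Qed.

Notation cmp p u := (p \mPo [tuple u j | j < n]).
Implicit Types (u v w : 'I_n -> {mpoly K[n]}).

Lemma cmpX m u : cmp 'X_[m] u = \prod_j u j ^+ m j.
Proof. by rewrite comp_mpolyX; apply: eq_bigr => j _; rewrite tnth_mktuple. Qed.

Lemma cmpXU i u : cmp 'X_i u = u i.
Proof. by rewrite comp_mpolyXU -tnth_nth tnth_mktuple. Qed.

Lemma eq_cmp p u v : u =1 v -> cmp p u = cmp p v.
Proof. by move=> E; congr (_ \mPo _); apply: eq_from_tnth => i; rewrite !tnth_mktuple. Qed.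

Lemma cmp_eqdr d p u v : (forall j, eqd d (u j) (v j)) -> eqd d (cmp p u) (cmp p v).
Proof.
move=> H; rewrite !comp_mpolyEX /eqd -sumrB; apply: low_sum => m _ _.
rewrite -scalerBr; apply: lowZ; rewrite !cmpX.
by apply: eqd_prod => j; apply: eqdX.
Qed.

Lemma low_cmpX u m : (forall j, low 1 (u j)) -> low (mdeg m) (cmp 'X_[m] u).
Proof.
move=> u0; rewrite cmpX mdegE; elim/big_ind2: _ => [|e p e' q|j _].
- by move=> m'.
- exact: lowM.
elim: (m j) => [|k IHk]; first by move=> m'.
by rewrite exprS -add1n; apply: lowM.
Qed.

Lemma low_cmp e p u : (forall j, low 1 (u j)) -> low e p -> low e (cmp p u).
Proof.
move=> u0 Hp; rewrite comp_mpolyEX; apply: low_sum => m mp _; apply: lowZ.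
apply: lowW (low_cmpX (m := m) u0); rewrite leqNgt; apply/negP => /Hp /eqP.
by rewrite mcoeff_eq0 mp.
Qed.

Lemma cmp_eqdl d p q u : (forall j, low 1 (u j)) ->
  eqd d p q -> eqd d (cmp p u) (cmp q u).
Proof. by move=> u0 H; rewrite /eqd -comp_mpolyB; apply: low_cmp. Qed.

Lemma cmpA p u v : cmp (cmp p u) v = cmp p (fun j => cmp (u j) v).
Proof.
rewrite [cmp p u]comp_mpolyEX [RHS]comp_mpolyEX linear_sum /=.
apply: eq_bigr => m _; rewrite comp_mpolyZ !cmpX rmorph_prod; congr (_ *: _).
by apply: eq_bigr => j _; rewrite rmorphXn.
Qed.

Lemma fixes0P f : reflect (forall i, f i 0%MM = 0) (fixes0 f).
Proof. exact: 'forall_eqP. Qed.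

Lemma low1_approx d p s : s 0%MM = 0 -> approx d p s -> low 1 p.
Proof.
by move=> s0 H m; rewrite ltnS leqn0 mdeg_eq0 => /eqP ->; rewrite H ?mdeg0.
Qed.

Lemma low1_trunc d f j : fixes0 f -> low 1 (fps_trunc d (f j)).
Proof.
by move/fixes0P => f0; apply: (@low1_approx d _ (f j)) => //; apply: approx_trunc.
Qed.

Lemma approx_comp d f g i p u : fixes0 g -> approx d p (f i) ->
  (forall j, approx d (u j) (g j)) -> approx d (cmp p u) (formal_comp f g i).
Proof.
move=> g0 Hp Hu m le_m; rewrite /formal_comp.
have /eqdP : eqd (mdeg m) (cmp p u)
  (cmp (fps_trunc (mdeg m) (f i)) (fun j => fps_trunc (mdeg m) (g j))); last exact.
apply: (@eqd_trans _ _ (cmp p (fun j => fps_trunc (mdeg m) (g j)))).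
  apply: cmp_eqdr => j; apply: approx_eqd (approx_trunc _ (leqnn _)).
  exact: approxW (Hu j).
apply: cmp_eqdl => [j|]; first exact: low1_trunc.
by apply: approx_eqd (approx_trunc _ (leqnn _)); apply: approxW Hp.
Qed.

Lemma fid_approx d i : approx d 'X_i (formal_id i).
Proof. by move=> m _; rewrite mcoeffX eq_sym. Qed.

Lemma fid0 : fixes0 formal_id.
Proof.
apply/fixes0P => i; rewrite /formal_id; case: eqP => // /(congr1 mdeg).
by rewrite mdeg0 mdeg1.
Qed.

Lemma fcomp0 f g : fixes0 f -> fixes0 g -> fixes0 (formal_comp f g).
Proof.
move=> f0 g0; apply/fixes0P => i.
have := approx_comp (d := 0) g0 (approx_trunc (f i) (leqnn 0))
  (fun j => approx_trunc (g j) (leqnn 0)) (m := 0%MM).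
rewrite mdeg0 => <- //; apply: (low_cmp (e := 1)); rewrite ?mdeg0 //.
- by move=> j; apply: low1_trunc.
- exact: low1_trunc.
Qed.

Lemma fcompA f g h : fixes0 g -> fixes0 h ->
  forall i m, formal_comp f (formal_comp g h) i m = formal_comp (formal_comp f g) h i m.
Proof.
move=> g0 h0 i m; set d := mdeg m.
pose u j := fps_trunc d (g j); pose v j := fps_trunc d (h j).
have Ht s : approx d (fps_trunc d s) s by apply: approx_trunc.
have := approx_comp (i := i) (fcomp0 g0 h0) (Ht (f i))
  (fun j => approx_comp (i := j) h0 (Ht (g j)) (fun k => Ht (h k))).
move=> /(_ m (leqnn _)) <-.
have := approx_comp (f := formal_comp f g) h0
  (approx_comp g0 (Ht (f i)) (fun j => Ht (g j))) (fun k => Ht (h k)).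
by move=> /(_ m (leqnn _)) <-; rewrite cmpA.
Qed.

Lemma fcomp1f f : fixes0 f -> forall i m, formal_comp formal_id f i m = f i m.
Proof.
move=> f0 i m; set d := mdeg m.
rewrite -(approx_comp f0 (@fid_approx d i)
  (fun j => approx_trunc (f j) (leqnn d))) //.
by rewrite cmpXU (approx_trunc _ (leqnn d)).
Qed.

Lemma fcompf1 f : forall i m, formal_comp f formal_id i m = f i m.
Proof.
move=> i m; set d := mdeg m.
rewrite -(approx_comp fid0 (approx_trunc (f i) (leqnn d)) (@fid_approx d)) //.
by rewrite comp_mpoly_id (approx_trunc _ (leqnn d)).
Qed.

Definition linmap (A : 'M[K]_n) (i : 'I_n) : {mpoly K[n]} :=
  \sum_j A i j *: 'X_j.

Lemma linmapU A i j : (linmap A i)@_U_(j) = A i j.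
Proof.
rewrite /linmap linear_sum (bigD1 j) //= big1 ?addr0 => [|k nkj].
  by rewrite mcoeffZ mcoeffX eqxx mulr1.
by rewrite mcoeffZ mcoeffX eq_mnm1 (negPf nkj) mulr0.
Qed.

Lemma low_linmap A i : low 1 (linmap A i).
Proof.
move=> m; rewrite ltnS leqn0 mdeg_eq0 => /eqP ->.
rewrite /linmap linear_sum big1 // => j _.
by rewrite /= mcoeffZ mcoeffX mnm1_eq0 mulr0.
Qed.

Lemma approx_lin f i : fixes0 f -> approx 1 (linmap (jac f) i) (f i).
Proof.
move=> /fixes0P f0 m; rewrite leq_eqVlt ltnS leqn0 mdeg_eq0.
case/orP => [|/eqP ->]; last by rewrite f0 low_linmap ?mdeg0.
by rewrite mdeg_eq1 => /existsP[j /eqP ->]; rewrite linmapU mxE.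
Qed.

Lemma cmp_linmap A i u : cmp (linmap A i) u = \sum_j A i j *: u j.
Proof.
rewrite linear_sum; apply: eq_bigr => j _ /=.
by rewrite comp_mpolyZ cmpXU.
Qed.

Lemma jac_comp f g : fixes0 f -> fixes0 g ->
  jac (formal_comp f g) = jac f *m jac g.
Proof.
move=> f0 g0; apply/matrixP => i j; rewrite !mxE.
rewrite -(approx_comp g0 (approx_lin i f0)
  (fun k => approx_lin k g0)) ?mdeg1 //.
rewrite cmp_linmap linear_sum; apply: eq_bigr => k _ /=.
by rewrite mcoeffZ linmapU !mxE.
Qed.

Lemma jac1 : jac formal_id = 1%:M.
Proof. by apply/matrixP => i j; rewrite !mxE /formal_id eq_mnm1 eq_sym. Qed.

(* The inverse of f is the fixed point of g |-> B (id - (f - A) o g), where A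
   is the linear part of f and B the inverse of A; each iteration determines
   one more homogeneous component. *)

Lemma cmpX_contract d m u v : (1 < mdeg m)%N ->
  (forall j, low 1 (u j)) -> (forall j, low 1 (v j)) ->
  (forall j, eqd d (u j) (v j)) -> eqd d.+1 (cmp 'X_[m] u) (cmp 'X_[m] v).
Proof.
move=> m2 u0 v0 uv.
have [j mj] : exists j, (0 < m j)%N.
  apply/existsP; apply: contraLR m2; rewrite negb_exists => /forallP H.
  rewrite mdegE big1 // => j _; by have := H j; rewrite lt0n negbK => /eqP.
have Em : m = (U_(j) + (m - U_(j)))%MM.
  rewrite addmC submK //; apply/mnm_lepP => k; rewrite mnm1E.
  by case: eqP => // <-.
set m' := (m - U_(j))%MM in Em.
have m'1 : (0 < mdeg m')%N by move: m2; rewrite Em mdegD mdeg1.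
rewrite Em mpolyXD !rmorphM /= !cmpXU /eqd -(subrKA (v j * cmp 'X_[m'] u)).
rewrite -mulrBl -mulrBr; apply: lowD.
  rewrite -addn1; apply: lowM; first exact: uv.
  by apply: lowW (low_cmpX (m := m') u0).
by rewrite -add1n; apply: lowM => //; apply: cmp_eqdr.
Qed.

Lemma cmp_contract d p u v : low 2 p ->
  (forall j, low 1 (u j)) -> (forall j, low 1 (v j)) ->
  (forall j, eqd d (u j) (v j)) -> eqd d.+1 (cmp p u) (cmp p v).
Proof.
move=> p2 u0 v0 uv; rewrite !comp_mpolyEX /eqd -sumrB; apply: low_sum => m mp _.
rewrite -scalerBr; apply: lowZ; apply: cmpX_contract => //.
by rewrite ltnNge -ltnS; apply/negP => /p2 /eqP; rewrite mcoeff_eq0 mp.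
Qed.

Section Inverse.
Variable f : formal_map.
Hypotheses (f0 : fixes0 f) (fJ : jac f \in unitmx).
Let A := jac f.
Let B := invmx A.

Let N d i : {mpoly K[n]} := fps_trunc d (f i) - linmap A i.
Let Phi d u i : {mpoly K[n]} := \sum_j B i j *: ('X_j - cmp (N d j) u).

Let low_N d i : low 2 (N d.+1 i).
Proof.
move=> m lt_m; rewrite mcoeffB approx_lin //.
by rewrite (approx_trunc (d := d.+1)) ?subrr // (leq_trans _ (ltn0Sn d)).
Qed.

Let low1_N d i : low 1 (N d i).
Proof. by apply: lowB; [apply: low1_trunc | apply: low_linmap]. Qed.

Let low_Phi d u : (forall j, low 1 (u j)) -> forall i, low 1 (Phi d u i).
Proof.
move=> u0 i; apply: low_sum => j _ _; apply: lowZ; apply: lowB.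
  by move=> m; rewrite ltnS leqn0 mdeg_eq0 => /eqP ->; rewrite mcoeffX mnm1_eq0.
by apply: low_cmp.
Qed.

Let eqd_Phi d e e' u v : (d <= e)%N -> (d <= e')%N ->
  (forall j, low 1 (u j)) -> (forall j, low 1 (v j)) ->
  (forall j, eqd d (u j) (v j)) -> forall i, eqd d (Phi e u i) (Phi e' v i).
Proof.
move=> le_e le_e' u0 v0 uv i; rewrite /eqd -sumrB; apply: low_sum => j _ _.
rewrite -scalerBr opprB addrC addrA subrK; apply: lowZ; apply: eqd_sym.
apply: (@eqd_trans _ _ (cmp (N e j) v)); first exact: cmp_eqdr.
apply: cmp_eqdl => //; rewrite /eqd opprB addrA subrK.
by apply: approx_eqd (approx_trunc _ le_e) (approx_trunc _ le_e').
Qed.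

Let contract_Phi d e u v :
  (forall j, low 1 (u j)) -> (forall j, low 1 (v j)) ->
  (forall j, eqd d (u j) (v j)) ->
  forall i, eqd d.+1 (Phi e.+1 u i) (Phi e.+1 v i).
Proof.
move=> u0 v0 uv i; rewrite /eqd -sumrB; apply: low_sum => j _ _.
rewrite -scalerBr opprB addrC addrA subrK; apply: lowZ; apply: eqd_sym.
exact: cmp_contract.
Qed.

Fixpoint inv_approx (d : nat) : 'I_n -> {mpoly K[n]} :=
  if d is d'.+1 then Phi d (inv_approx d') else fun=> 0.

Let low_G d i : low 1 (inv_approx d i).
Proof. by elim: d i => [|d IHd] i; [apply: low0 | apply: low_Phi]. Qed.

Let G_step d i : eqd d (inv_approx d i) (inv_approx d.+1 i).
Proof.
elim: d i => [|d IHd] i.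
  exact: (@lowB 1 0 (inv_approx 1 i) (@low0 1) (low_G 1 i)).
apply: (@eqd_trans _ _ (Phi d.+1 (inv_approx d.+1) i)).
  exact: (@contract_Phi d d _ _ (low_G d) (low_G d.+1) IHd i).
apply: (@eqd_Phi d.+1 d.+1 d.+2 _ _ (leqnn _) (leqnSn _) (low_G d.+1) (low_G d.+1)) => j.
exact: eqd_refl.
Qed.

Let G_eqd d e i : (d <= e)%N -> eqd d (inv_approx d i) (inv_approx e i).
Proof.
elim: e => [|e IHe]; first by rewrite leqn0 => /eqP ->; apply: eqd_refl.
rewrite leq_eqVlt => /orP[/eqP -> //|]; first exact: eqd_refl.
rewrite ltnS => le_d; apply: eqd_trans (IHe le_d) _.
by apply: lowW (@G_step e i); rewrite ltnS.
Qed.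

Definition formal_inv : formal_map := fun i m => (inv_approx (mdeg m) i)@_m.

Let finv_approx d i : approx d (inv_approx d i) (formal_inv i).
Proof.
by move=> m le_m; rewrite /formal_inv; have /eqdP -> := @G_eqd (mdeg m) d i le_m.
Qed.

Lemma finv0 : fixes0 formal_inv.
Proof. by apply/fixes0P => i; rewrite /formal_inv low_G ?mdeg0. Qed.

Lemma fcomp_finv i m : formal_comp f formal_inv i m = formal_id i m.
Proof.
set d := mdeg m; pose G := inv_approx d.
have G0 : forall j, low 1 (G j) by move=> j; apply: low_G.
have GE j : eqd d (G j) (Phi d G j).
  apply: eqd_trans (@G_step d j) _; rewrite /=.
  apply: eqd_Phi => //; last by move=> k; apply: eqd_refl.
have := approx_comp finv0 (approx_trunc (f i) (leqnn d)) (@finv_approx d).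
move=> /(_ m (leqnn _)) <-; rewrite -(@fid_approx d i m (leqnn _)).
have -> : fps_trunc d (f i) = linmap A i + N d i by rewrite addrC subrK.
suff /eqdP H : eqd d (cmp (linmap A i + N d i) G) 'X_i by rewrite H.
rewrite comp_mpolyD cmp_linmap.
have -> : 'X_i = \sum_j A i j *: Phi d G j + cmp (N d i) G.
  under eq_bigr => j _ do rewrite /Phi scaler_sumr.
  rewrite exchange_big /=.
  have H k : \sum_j A i j *: (B j k *: ('X_k - cmp (N d k) G)) =
             (i == k)%:R *: ('X_k - cmp (N d k) G).
    under eq_bigr => j _ do rewrite scalerA.
    rewrite -scaler_suml; have := congr1 (fun M : 'M_n => M i k) (mulmxV fJ).
    by rewrite !mxE => ->.
  under eq_bigr => k _ do rewrite H.
  rewrite (bigD1 i) //= eqxx scale1r big1 => [|k nki].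
    by rewrite addr0 subrK.
  by rewrite eq_sym (negPf nki) scale0r.
rewrite /eqd opprD addrACA subrr addr0 -sumrB; apply: low_sum => j _ _.
by rewrite -scalerBr; apply: lowZ; apply: GE.
Qed.

Lemma jac_finv : jac formal_inv \in unitmx.
Proof.
have E : formal_comp f formal_inv = formal_id.
  by apply/funext => i; apply/funext => m; apply: fcomp_finv.
have := jac_comp f0 finv0; rewrite E jac1 => /esym /mulmx1_unit.
by case.
Qed.

End Inverse.

Lemma jac_fcomp_unit (x y : fdiff) : jac (formal_comp x y) \in unitmx.
Proof.
by rewrite jac_comp ?fdiff_fixes0 // unitmx_mul !fdiff_jac.
Qed.

Lemma jac_fid_unit : jac formal_id \in unitmx.
Proof. by rewrite jac1 unitmx1. Qed.

Definition fdiff_mul (x y : fdiff) : fdiff :=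
  FDiff (fcomp0 (fdiff_fixes0 x) (fdiff_fixes0 y)) (jac_fcomp_unit x y).

Definition fdiff_one : fdiff := FDiff fid0 jac_fid_unit.

Definition fdiff_inv (x : fdiff) : fdiff :=
  FDiff (finv0 (fdiff_fixes0 x))
        (jac_finv (fdiff_fixes0 x) (fdiff_jac x)).

Lemma fdiff_mulA : associative fdiff_mul.
Proof.
by move=> x y z; apply: fdiff_inj => i m; apply: fcompA; apply: fdiff_fixes0.
Qed.

Lemma fdiff_mul1 : left_id fdiff_one fdiff_mul.
Proof.
by move=> x; apply: fdiff_inj => i m; apply: fcomp1f; apply: fdiff_fixes0.
Qed.

Lemma fdiff_mulr1 : right_id fdiff_one fdiff_mul.
Proof. by move=> x; apply: fdiff_inj => i m; apply: fcompf1. Qed.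

Lemma fdiff_mulV : right_inverse fdiff_one fdiff_inv fdiff_mul.
Proof.
move=> x; apply: fdiff_inj => i m.
by apply: fcomp_finv; [apply: fdiff_fixes0 | apply: fdiff_jac].
Qed.

Lemma fdiff_mulVx : left_inverse fdiff_one fdiff_inv fdiff_mul.
Proof.
move=> x; suff {2}-> : x = fdiff_inv (fdiff_inv x) by apply: fdiff_mulV.
by rewrite -[LHS]fdiff_mulr1 -(fdiff_mulV (fdiff_inv x)) fdiff_mulA fdiff_mulV
           fdiff_mul1.
Qed.

(* x * y is the composite z |-> x (y z). *)
HB.instance Definition _ := isGroup.Build fdiff
  fdiff_mulA fdiff_mul1 fdiff_mulr1 fdiff_mulVx fdiff_mulV.

End FormalMaps.

Arguments fdiff : clear implicits.

Section TangentToIdentity.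
Variables (K : fieldType) (n : nat).
Implicit Types f : fdiff K n.

Definition Diff_Id : set (fdiff K n) := [set f | jac f = 1%:M].

Definition tangent_order (k : nat) f : Prop :=
  [/\ (0 < k)%N,
      Diff_Id f,
      forall i j, (1 < j <= k)%N -> fps_hpart j (f i) = 0
    & exists i, fps_hpart k.+1 (f i) <> 0].

Definition dicritic (k : nat) f : Prop :=
  tangent_order k f /\
  exists2 p : {mpoly K[n]}, p \is k.-homog for mdeg
    & forall i, fps_hpart k.+1 (f i) = p * 'X_i.

End TangentToIdentity.

Local Open Scope group_scope.
Local Open Scope classical_set_scope.

Section Groups.
Variable T : groupType.
Implicit Types G H : set T.

Definition is_subgroup G : Prop :=
  [/\ G 1, forall x y, G x -> G y -> G (x * y) & forall x, G x -> G x^-1].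

Definition is_abelian G : Prop := forall x y, G x -> G y -> x * y = y * x.

Definition commutator_subgroup G H : set T :=
  smallest is_subgroup [set z | exists x y, [/\ G x, H y & z = [~ x, y]]].

Fixpoint lower_central G (c : nat) : set T :=
  if c is c'.+1 then commutator_subgroup (lower_central G c') G else G.

Definition is_nilpotent G : Prop := exists c, lower_central G c = [set 1].

End Groups.

(* Main.v *)
(* Write x = z + X + ... and y = z + Y + ... with X, Y homogeneous of degrees
   a + 1 and b + 1. Comparing x y = y x [~ x, y] with first-order Taylor
   expansions gives [~ x, y] = z + [X, Y] + ..., where the Lie bracket [X, Y] is
   homogeneous of degree a + b + 1. If all nontrivial elements have order k, a
   commutator has order at least 2k or is trivial, hence is trivial. For
   Y = p z with p homogeneous of degree k, Euler's identity gives
   [X, Y] = a p X - X(p) z; if it vanishes, applying the derivation to p gives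
   (a - k) p X(p) = 0, so X = 0 when a <> k. Thus in a group containing a
   dicritic f of order k, an element g of order l <> k yields iterated
   commutators [~ g, f, ..., f] of order l + j k <> k, all nontrivial, and the
   group is not nilpotent. *)
Require Import Defs.
From mathcomp Require Import all_boot all_order all_algebra.
From mathcomp Require Import mpoly.
From mathcomp Require Import boolp classical_sets reals.
From mathcomp Require Import complex.
From mathcomp Require Import ring zify.

Section LeadingTerms.

Import GRing.Theory.
Local Open Scope ring_scope.
Set Implicit Arguments.
Unset Strict Implicit.

Variables (K : fieldType) (n : nat).
Implicit Types (p q : {mpoly K[n]}) (u v X Y : 'I_n -> {mpoly K[n]}).
Implicit Types (x y z : fdiff K n).

Notation cmp p u := (p \mPo [tuple u j | j < n]).

(** * Derivations along polynomial vector fields and the first-order Taylor formula *)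

Definition der u p : {mpoly K[n]} := \sum_j p^`M(j) * u j.

Lemma der0 u : der u 0 = 0.
Proof. by rewrite /der big1 // => j _; rewrite mderiv0 mul0r. Qed.

Lemma der1 u : der u 1 = 0.
Proof. by rewrite /der big1 // => j _; rewrite -mpolyC1 mderivC mul0r. Qed.

Lemma derD u p q : der u (p + q) = der u p + der u q.
Proof. by rewrite /der -big_split /=; apply: eq_bigr => j _; rewrite mderivD mulrDl. Qed.

Lemma derZ u c p : der u (c *: p) = c *: der u p.
Proof.
by rewrite /der scaler_sumr; apply: eq_bigr => j _; rewrite mderivZ scalerAl.
Qed.

Lemma derBl u v p : der u p - der v p = der (fun j => u j - v j) p.
Proof. by rewrite /der -sumrB; apply: eq_bigr => j _; rewrite mulrBr. Qed.

Lemma derB u p q : der u (p - q) = der u p - der u q.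
Proof. by rewrite derD -[- q]scaleN1r derZ scaleN1r. Qed.

Lemma derM u p q : der u (p * q) = der u p * q + p * der u q.
Proof.
rewrite /der mulr_suml mulr_sumr -big_split; apply: eq_bigr => j _ /=.
by rewrite mderivM; ring.
Qed.

Lemma derX u i : der u 'X_i = u i.
Proof.
rewrite /der (bigD1 i) //= big1 => [|j nji].
  rewrite mderivX mnm1E eqxx scale1r addr0.
  have -> : (U_(i) - U_(i))%MM = 0%MM :> 'X_{1..n}.
    by apply/mnmP => j; rewrite mnmBE subnn mnm0E.
  by rewrite mpolyX0 mul1r.
by rewrite mderivX mnm1E eq_sym (negPf nji) scale0r mul0r.
Qed.

Lemma der_mulv p u q : der (fun j => p * u j) q = p * der u q.
Proof. by rewrite /der mulr_sumr; apply: eq_bigr => j _; rewrite mulrCA. Qed.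

Lemma euler d p : p \is d.-homog for mdeg ->
  der (fun j => 'X_j) p = d%:R * p.
Proof.
have euler_mon m : der (fun j => 'X_j) 'X_[m] = (mdeg m)%:R * 'X_[m] :> {mpoly K[n]}.
  (* The identity passes to products, degrees adding up, so [big_ind2] runs through the factors of
     the monomial and the summands of its degree together. *)
  rewrite mpolyXE_id mdegE.
  elim/big_ind2: _ => [|a b e q Ha Hb|j _]; first by rewrite der1 mul0r.
    by rewrite derM Ha Hb natrD; ring.
  elim: (m j) => [|k IHk]; first by rewrite expr0 der1 mul0r.
  by rewrite exprS derM derX IHk -[k.+1]add1n natrD; ring.
move=> /dhomogP hp; rewrite [p]mpolyE.
rewrite (big_morph _ (derD _) (der0 _)) mulr_sumr; apply: eq_big_seq => m mp.
by rewrite derZ euler_mon (hp _ mp) scalerAr.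
Qed.

(* The degree bounds are chosen so that the three conditions are stable under
   products, which reduces them to the variables. *)
Definition taylor1 b u e p :=
  [/\ low e p, low (e + b) (der u p) &
      low (e + b + b) (cmp p (fun j => 'X_j + u j) - p - der u p)].

Lemma taylor1M b u e e' p q :
  taylor1 b u e p -> taylor1 b u e' q -> taylor1 b u (e + e') (p * q).
Proof.
move=> [p0 p1 p2] [q0 q1 q2]; split; first exact: lowM.
  rewrite derM; apply: lowD.
    by rewrite addnAC; apply: lowM.
  by rewrite -addnA; apply: lowM.
rewrite rmorphM derM /=; set t := mktuple _ in p2 q2 *.
move: (p \mPo t) (q \mPo t) p2 q2 => p' q' p2 q2.
(* Substitute [p' = p + der u p + r] and [q' = q + der u q + s]: the terms of order 0 and 1 cancel,
   and each of the six remaining products contains [r], [s] or both derivatives, so it gains [b]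
   twice. *)
have -> : p' * q' - p * q - (der u p * q + p * der u q) =
  (p' - p - der u p) * q + ((p' - p - der u p) * der u q +
  (p' - p - der u p) * (q' - q - der u q)) +
  ((p + der u p) * (q' - q - der u q) + der u p * der u q) by ring.
have lM a a' f g : low a f -> low a' g -> (e + e' + b + b <= a + a')%N ->
   low (e + e' + b + b) (f * g).
  by move=> lf lg le; apply: lowW le _; apply: lowM.
rewrite [(p + _) * _]mulrDl; do !apply: lowD.
- by apply: lM p2 q0 _; lia.
- by apply: lM p2 q1 _; lia.
- by apply: lM p2 q2 _; lia.
- by apply: lM p0 q2 _; lia.
- by apply: lM p1 q2 _; lia.
- by apply: lM p1 q1 _; lia.
Qed.

Lemma taylor1_1 b u : taylor1 b u 0 1.
Proof.
split=> //; first by rewrite der1; apply: low0.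
by rewrite der1 rmorph1 subrr subr0; apply: low0.
Qed.

Lemma low_X (i : 'I_n) : low 1 ('X_i : {mpoly K[n]}).
Proof.
by move=> m; rewrite ltnS leqn0 mdeg_eq0 => /eqP ->; rewrite mcoeffX mnm1_eq0.
Qed.

Lemma taylor1_X b u i : (forall j, low b.+1 (u j)) -> taylor1 b u 1 'X_i.
Proof.
move=> lu; split; first exact: low_X.
  by rewrite derX add1n; apply: lu.
by rewrite derX cmpXU addrAC addrK subrr; apply: low0.
Qed.

(** Every monomial of [p] has degree at least [e] and is a product of variables, so [taylor1_X] and
    [taylor1M] suffice. The middle bound is also used alone: [der u] raises degrees by [b]. *)
Lemma taylor1_low b u e p : (forall j, low b.+1 (u j)) -> low e p ->
  taylor1 b u e p.
Proof.
move=> lu lp; rewrite [p]mpolyE big_seq_cond.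
apply: (big_ind (taylor1 b u e)) => [|p' q' [p0 p1 p2] [q0 q1 q2]|m].
- split; [exact: low0 | rewrite der0; exact: low0 |].
  by rewrite der0 comp_mpoly0 !subr0; apply: low0.
- split; [exact: lowD | by rewrite derD; apply: lowD |].
  rewrite derD comp_mpolyD; move: (lowD p2 q2); congr low.
  ring.
rewrite andbT => mp.
have em : (e <= mdeg m)%N.
  by rewrite leqNgt; apply/negP => /lp /eqP; rewrite mcoeff_eq0 mp.
have [m0 m1 m2] : taylor1 b u (mdeg m) 'X_[m].
  rewrite mpolyXE_id mdegE.
  elim/big_ind2: _ => [|*|j _]; [exact: taylor1_1 | exact: taylor1M |].
  elim: (m j) => [|k IHk]; first exact: taylor1_1.
  by rewrite exprS -add1n; apply: taylor1M => //; apply: taylor1_X.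
split; first by apply/lowZ/(lowW em).
  by rewrite derZ; apply: lowZ; apply: lowW m1; rewrite leq_add2r.
rewrite derZ comp_mpolyZ -!scalerBr; apply: lowZ; apply: lowW m2.
by rewrite !leq_add2r.
Qed.

(** * The Lie bracket as leading term of a commutator *)

Definition bracket X Y i : {mpoly K[n]} := der Y (X i) - der X (Y i).

(* x = z + X + O(degree a + 2) with X of degree at least a + 1; X need not be
   homogeneous. *)
Definition leading a x X := forall i, low a.+1 (X i) /\ approx a.+1 ('X_i + X i) (x i).

Lemma low_bracket a b X Y i : (forall j, low a.+1 (X j)) ->
  (forall j, low b.+1 (Y j)) -> low (a + b).+1 (bracket X Y i).
Proof.
move=> lX lY; apply: lowB; first by case: (taylor1_low lY (lX i)).
by rewrite addnC; case: (taylor1_low lX (lY i)).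
Qed.

(** Left cancellation by a map tangent to the identity, one degree at a time: [H - id] has no terms
    of degree below 2, so its values at [u] and [v] agree one degree further than [u] and [v] do. *)
Lemma comp_inj d (H : 'I_n -> {mpoly K[n]}) u v :
  (forall i, low 2 (H i - 'X_i)) ->
  (forall i, low 1 (u i)) -> (forall i, low 1 (v i)) ->
  (forall i, eqd d (cmp (H i) u) (cmp (H i) v)) -> forall i, eqd d (u i) (v i).
Proof.
move=> lH lu lv E; suff Huv e : (e <= d)%N -> forall i, eqd e (u i) (v i) by exact: Huv.
elim: e => [_ i|e IHe le i]; first exact: lowB.
have := cmp_contract (lH i) lu lv (IHe (ltnW le)).
rewrite /eqd !comp_mpolyB !cmpXU => HR.
have -> : u i - v i = (cmp (H i) u - cmp (H i) v) -
  (cmp (H i) u - u i - (cmp (H i) v - v i)) by ring.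
by apply: lowB HR; apply: lowW (E i).
Qed.

Lemma leading_trunc d a x X i : leading a x X -> (a < d)%N ->
  low a.+1 (fps_trunc d (x i) - 'X_i) /\ low a.+2 (fps_trunc d (x i) - 'X_i - X i).
Proof.
move=> /(_ i)[lX xX] ad.
have E : low a.+2 (fps_trunc d (x i) - 'X_i - X i).
  by rewrite -addrA -opprD; apply: approx_eqd xX; apply: approx_trunc.
split=> //; rewrite -[_ - 'X_i](subrK (X i)); apply: lowD lX.
exact: lowW E.
Qed.

(** By bilinearity, a change of [X] or [Y] in the next degree moves the bracket only in the next
    degree. This lets [X] and [Y] replace the truncations. *)
Lemma bracket_congr a b X Y (P Q : 'I_n -> {mpoly K[n]}) i :
  (forall j, low a.+1 (P j)) -> (forall j, low b.+1 (Q j)) ->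
  (forall j, low a.+1 (X j)) -> (forall j, low b.+1 (Y j)) ->
  (forall j, low a.+2 (P j - X j)) -> (forall j, low b.+2 (Q j - Y j)) ->
  low (a + b).+2 (bracket P Q i - bracket X Y i).
Proof.
move=> lP lQ lX lY PX QY.
have der_congr a' b' u v p q : (forall j, low b'.+1 (v j)) ->
    (forall j, low b'.+2 (u j - v j)) -> low a'.+1 p -> low a'.+2 (p - q) ->
    low (a' + b').+2 (der u p - der v q).
  move=> lv luv lp lpq.
  have -> : der u p - der v q = (der u p - der v p) + (der v p - der v q) by ring.
  apply: lowD.
    by rewrite derBl; case: (taylor1_low luv lp) => _; rewrite addSn addnS.
  by rewrite -derB; case: (taylor1_low lv lpq).
rewrite (_ : _ - _ = (der Q (P i) - der Y (X i)) - (der P (Q i) - der X (Y i)));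
  last by rewrite /bracket; ring.
apply: lowB; first exact: der_congr.
by rewrite addnC; apply: der_congr.
Qed.

Lemma leading_commg a b x y X Y : (0 < a)%N -> (0 < b)%N ->
  leading a x X -> leading b y Y -> leading (a + b) [~ x, y]%g (bracket X Y).
Proof.
move=> a0 b0 xX yY; set d := (a + b).+1.
pose xt i := fps_trunc d (x i); pose yt i := fps_trunc d (y i).
pose P i := xt i - 'X_i; pose Q i := yt i - 'X_i.
have lX i : low a.+1 (X i) by case: (xX i).
have lY i : low b.+1 (Y i) by case: (yY i).
have lB i := low_bracket i lX lY.
have [lP PX] : (forall i, low a.+1 (P i)) /\ (forall i, low a.+2 (P i - X i)).
  by split=> i; case: (leading_trunc i xX (d := d)) => //; rewrite ltnS leq_addr.
have [lQ QY] : (forall i, low b.+1 (Q i)) /\ (forall i, low b.+2 (Q i - Y i)).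
  by split=> i; case: (leading_trunc i yY (d := d)) => //; rewrite ltnS leq_addl.
pose xy i := cmp (xt i) yt; pose yx i := cmp (yt i) xt.
have compE u v i : cmp (u i) v =
    v i + cmp (u i - 'X_i) (fun j => 'X_j + (v j - 'X_j)).
  rewrite (@eq_cmp _ _ _ (fun j => 'X_j + (v j - 'X_j)) v) => [|j].
    by rewrite comp_mpolyB cmpXU addrC subrK.
  by rewrite addrC subrK.
(* Used with [(e, e')] equal to [(a, b)] and [(b, a)]; the degree condition then amounts to [b > 0]
   and [a > 0]. *)
have lin e e' (u : 'I_n -> {mpoly K[n]}) p : (forall j, low e'.+1 (u j)) -> low e.+1 p ->
    (d < e.+1 + e' + e')%N ->
    low d.+1 (cmp p (fun j => 'X_j + u j) - p - der u p).
  by move=> lu lp le; case: (taylor1_low lu lp) => _ _; apply: lowW.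
(* Both composites contain ['X_i + P i + Q i]; their first-order terms [der Q (P i)] and
   [der P (Q i)] differ by the bracket, which fixes its sign. *)
have commE i : eqd d (xy i) (yx i + bracket X Y i).
  have PQ := lin _ _ _ _ lQ (lP i); have QP := lin _ _ _ _ lP (lQ i).
  have := bracket_congr i lP lQ lX lY PX QY.
  rewrite /eqd /xy /yx (compE xt) (compE yt) -/(P i) -/(Q i) => HB.
  rewrite -[yt i](subrK 'X_i) -[xt i](subrK 'X_i) -/(P i) -/(Q i).
  rewrite (_ : _ - _ =
    (cmp (P i) (fun j => 'X_j + Q j) - P i - der Q (P i)) -
    (cmp (Q i) (fun j => 'X_j + P j) - Q i - der P (Q i)) +
    (bracket P Q i - bracket X Y i)); last by rewrite /bracket; ring.
  apply: lowD HB; apply: lowB; [apply: PQ | apply: QP]; rewrite /d; lia.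
have lxt i : low 1 (xt i) by apply/low1_trunc/fdiff_fixes0.
have lyx i : low 2 (yx i - 'X_i).
  rewrite /yx (compE yt) addrAC; apply: lowD; first by apply: lowW (lP i).
  apply: low_cmp => [j|]; last by apply: lowW (lQ i).
  by rewrite addrC subrK.
pose ct i := fps_trunc d ([~ x, y]%g i).
(* No inverse is expanded: both sides agree with [x * y], the left by [x * y = y * x * [~ x, y]],
   the right because [yx - id] starts in degree 2 and so feels the bracket only beyond degree [d].
   Then [comp_inj] cancels [yx]. *)
have Hc i : eqd d (cmp (yx i) ct) (cmp (yx i) (fun j => 'X_j + bracket X Y j)).
  apply: (@eqd_trans _ _ _ _ (xy i)).
    apply: (@approx_eqd _ _ _ _ _ ((x * y)%g i)).
      rewrite commgC; apply: approx_comp => [||j]; first exact: fdiff_fixes0.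
        apply: approx_comp => [||j]; first exact: fdiff_fixes0.
          exact: approx_trunc.
        exact: approx_trunc.
      exact: approx_trunc.
    apply: approx_comp => [||j]; first exact: fdiff_fixes0.
      exact: approx_trunc.
    exact: approx_trunc.
  apply: eqd_trans (commE i) _; apply: eqd_sym.
  have [_ l1 l2] := taylor1_low lB (lyx i).
  rewrite /eqd (_ : _ - _ = (cmp (yx i - 'X_i) (fun j => 'X_j + bracket X Y j) -
    (yx i - 'X_i) - der (bracket X Y) (yx i - 'X_i)) +
    der (bracket X Y) (yx i - 'X_i)); last by rewrite comp_mpolyB cmpXU; ring.
  by apply: lowD; [apply: lowW l2 | apply: lowW l1]; rewrite /d; lia.
move=> i; split=> //.
have lC j : low 1 ('X_j + bracket X Y j).
  by apply: lowD; [apply: low_X | apply: lowW (lB j)].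
have lct j : low 1 (ct j) by apply/low1_trunc/fdiff_fixes0.
apply: eqd_approx (eqd_sym (comp_inj lyx lct lC Hc i)) _.
exact: approx_trunc.
Qed.

(** * Homogeneous parts and the order of tangency *)

Lemma mcoeff_pihomog d p m :
  (pihomog mdeg d p)@_m = if mdeg m == d then p@_m else 0.
Proof.
case: eqP => [Em|/eqP nEm]; last exact/(dhomog_nemf_coeff (pihomogP _ _ _)).
rewrite {2}[p]mpolyE (bigID (fun m' => mdeg m' == d)) /= mcoeffD -pihomogE.
rewrite [X in _ + X]raddf_sum [X in _ + X]big1 ?addr0 // => m' /eqP nm' /=.
by rewrite mcoeffZ mcoeffX; case: eqP => [E|]; rewrite ?mulr0 //; case: nm'; rewrite E.
Qed.

Lemma mcoeff_hpart d (s : fps K n) m :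
  (fps_hpart d s)@_m = if mdeg m == d then s m else 0.
Proof.
rewrite mcoeff_pihomog; case: eqP => // E.
by rewrite (approx_trunc (d := d)) // E.
Qed.

Lemma hpart_homog d (s : fps K n) : fps_hpart d s \is d.-homog for mdeg.
Proof. exact: pihomogP. Qed.

Lemma dhomog_low d p : p \is d.-homog for mdeg -> low d p.
Proof. by move=> hp m lm; apply: (dhomog_nemf_coeff hp); rewrite neq_ltn lm. Qed.

Lemma approx1_Diff_Id x i : Diff_Id x -> approx 1 'X_i (x i).
Proof.
move=> x1; suff -> : 'X_i = linmap (jac x) i by apply/approx_lin/fdiff_fixes0.
rewrite /linmap x1 (bigD1 i) //= big1 => [|j nji]; first by rewrite !mxE eqxx scale1r addr0.
by rewrite !mxE eq_sym (negPf nji) scale0r.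
Qed.

Lemma mcoeffX_gt1 (i : 'I_n) (m : 'X_{1..n}) : (1 < mdeg m)%N -> ('X_i : {mpoly K[n]})@_m = 0.
Proof. by rewrite mcoeffX; case: eqP => // <-; rewrite mdeg1. Qed.

Lemma tangent_order_leading l x : tangent_order l x ->
  leading l x (fun i => fps_hpart l.+1 (x i)).
Proof.
case=> l0 x1 xl _ i; split; first exact/dhomog_low/hpart_homog.
move=> m le; rewrite mcoeffD mcoeff_hpart.
have [le1|gt1] := leqP (mdeg m) 1.
  rewrite (approx1_Diff_Id i x1) //; case: eqP => [E|]; last by rewrite addr0.
  by move: le1; rewrite E ltnS leqNgt l0.
rewrite mcoeffX_gt1 // add0r; case: eqP => // /eqP ne.
have lt : (1 < mdeg m <= l)%N by rewrite gt1 -ltnS ltn_neqAle ne.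
by have := congr1 (mcoeff m) (xl i _ lt); rewrite mcoeff_hpart eqxx mcoeff0.
Qed.

Lemma leading_hpart0 l x X i j : leading l x X -> (1 < j <= l)%N ->
  fps_hpart j (x i) = 0.
Proof.
move=> /(_ i)[lX xX] /andP[j1 jl]; apply/mpolyP => m.
rewrite mcoeff_hpart mcoeff0; case: eqP => // E.
by rewrite -xX ?E ?leqW // mcoeffD lX ?E // addr0 mcoeffX_gt1 // E.
Qed.

Lemma leading_neq1 l x X i : (0 < l)%N -> leading l x X ->
  X i \is l.+1.-homog for mdeg -> X i <> 0 -> x <> 1%g.
Proof.
move=> l0 /(_ i)[_ xX] hX nX x1; apply: nX; apply/mpolyP => m; rewrite mcoeff0.
have [le|gt] := leqP (mdeg m) l.+1; last first.
  by apply: (dhomog_nemf_coeff hX); rewrite neq_ltn gt orbT.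
apply: (addrI ('X_i)@_m); rewrite -mcoeffD xX // x1 addr0.
by rewrite mcoeffX eq_sym.
Qed.

(** The order is one less than the least degree in which [x] differs from the identity; that degree
    exceeds 1 because the linear part is the identity. *)
Lemma exists_tangent_order x : Diff_Id x -> x <> 1%g -> exists l, tangent_order l x.
Proof.
move=> x1 nx.
pose ord d := `[< exists i m, mdeg m = d /\ x i m <> formal_id K i m >].
have exd : exists d, ord d.
  apply: contra_notP nx => no; apply: fdiff_inj => i m.
  apply: contra_notP no => H; exists (mdeg m); apply/asboolP; by exists i, m.
case: (ex_minnP exd) => d /asboolP[i [m [md xm]]] dmin.
have xE j m' : (mdeg m' < d)%N -> x j m' = formal_id K j m'.
  move=> lt; apply: contrapT => H; move: lt; rewrite ltnNge dmin //.
  by apply/asboolP; exists j, m'.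
have idE j (m' : 'X_{1..n}) : (1 < mdeg m')%N -> formal_id K j m' = 0.
  by move=> gt; have := mcoeffX_gt1 j gt; rewrite mcoeffX eq_sym.
have d1 : (1 < d)%N.
  rewrite ltnNge; apply/negP => le; apply: xm.
  by rewrite -(approx1_Diff_Id i x1) ?md // mcoeffX eq_sym.
case: d md xE {dmin} d1 => [//|l] md xE l1; exists l; split=> //.
  move=> j e /andP[e1 el]; apply/mpolyP => m'; rewrite mcoeff_hpart mcoeff0.
  by case: eqP => // E; rewrite xE ?idE ?E //; rewrite ltnS.
exists i => /(congr1 (mcoeff m)); rewrite mcoeff_hpart mcoeff0 md eqxx => H.
by apply: xm; rewrite H idE ?md.
Qed.

Lemma dhomog_der d e u p : p \is d.+1.-homog for mdeg ->
  (forall j, u j \is e.-homog for mdeg) -> der u p \is (d + e).-homog for mdeg.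
Proof.
move=> hp hu; apply: rpred_sum => j _; apply: dhomogM => //.
apply/dhomogP => m; apply: contraTeq => ne; rewrite -mcoeff_eq0 mcoeff_deriv.
by rewrite (dhomog_nemf_coeff hp) ?mul0rn //= mdegD mdeg1 addn1 eqSS.
Qed.

Lemma dhomog_bracket d e X Y i : (forall j, X j \is d.+1.-homog for mdeg) ->
  (forall j, Y j \is e.+1.-homog for mdeg) ->
  bracket X Y i \is (d + e).+1.-homog for mdeg.
Proof.
move=> hX hY; apply: rpredB; first by rewrite -addnS; apply: dhomog_der.
by rewrite addnC -addnS; apply: dhomog_der.
Qed.

End LeadingTerms.

(** * The bracket with a multiple of the radial field *)

Section DicriticBracket.

Import GRing.Theory Num.Theory.
Local Open Scope ring_scope.

(** Characteristic zero enters the argument here. *)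
Lemma mpoly_natr_inj (K : numFieldType) (n l k : nat) :
  l%:R = k%:R :> {mpoly K[n]} -> l = k.
Proof.
rewrite -!mpolyC_nat => /(congr1 (mcoeff 0%MM)).
by rewrite !mcoeffC eqxx !mulr1 => /eqP; rewrite eqr_nat => /eqP.
Qed.

Lemma bracket_euler_eq0 (K : numFieldType) (n l k : nat)
    (X : 'I_n -> {mpoly K[n]}) (p : {mpoly K[n]}) :
  (0 < l)%N -> l <> k -> p != 0 -> p \is k.-homog for mdeg ->
  (forall i, X i \is l.+1.-homog for mdeg) ->
  (forall i, bracket X (fun j => p * 'X_j) i = 0) -> forall i, X i = 0.
Proof.
move=> l0 nlk p0 hp hX B0.
(* Euler's identity gives [(l + 1) * p * X i] for the first term of the bracket, and one [p * X i]
   cancels against the product rule in the second. *)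
have eqX i : l%:R * p * X i = der X p * 'X_i.
  move: (B0 i); rewrite /bracket der_mulv (euler (hX i)) derM derX -natr1 => E.
  by apply/eqP; rewrite -subr_eq0 -[X in _ == X]E; apply/eqP; ring.
(* Pair [eqX] with the gradient of [p]; Euler's identity for [p] turns the right side into
   [k * p * der X p]. *)
have /eqP : (l%:R - k%:R) * (p * der X p) = 0.
  have : \sum_i p^`M(i) * (l%:R * p * X i) = \sum_i p^`M(i) * (der X p * 'X_i).
    by apply: eq_bigr => i _; rewrite eqX.
  rewrite -/(der (fun i => l%:R * p * X i) p) -/(der (fun i => der X p * 'X_i) p).
  by rewrite !der_mulv (euler hp) => E; rewrite mulrBl mulrA E; ring.
rewrite !mulf_eq0 subr_eq0 (negPf p0) orFb => /orP[/eqP/mpoly_natr_inj //|/eqP q0] i.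
apply/eqP; have /eqP := eqX i.
rewrite q0 mul0r !mulf_eq0 (negPf p0) orbF => /orP[/eqP|//].
by move/(@mpoly_natr_inj _ _ _ 0) => E; rewrite E in l0.
Qed.

End DicriticBracket.

(** * The cycle of implications *)

Section MainArgument.

Import GRing.Theory.

Local Open Scope classical_set_scope.
Local Open Scope group_scope.

Lemma abelian_nilpotent (T : groupType) (G : set T) :
  is_subgroup G -> is_abelian G -> is_nilpotent G.
Proof.
(* The series starts with [G] at index 0, so index 1 is the commutator subgroup. *)
move=> [G1 _ _] abG; exists 1%N; apply/seteqP; split=> /=.
  apply: smallest_sub => [|z [x [y [Gx Gy ->]]]].
    by split=> [//|x y -> ->|x ->]; rewrite /= ?mulg1 ?invg1.
  by apply/eqP/commgP/abG.
by move=> _ -> H [[]].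
Qed.

Lemma lower_central_commg (T : groupType) (G : set T) c x y :
  lower_central G c x -> G y -> lower_central G c.+1 [~ x, y].
Proof. by move=> Gx Gy; apply: sub_gen_smallest; exists x, y. Qed.

Lemma nilpotent_order (K : numFieldType) (n k : nat) (G : set (fdiff K n)) f :
  G `<=` @Diff_Id K n -> G f -> dicritic k f -> is_nilpotent G ->
  forall g, G g -> g <> 1 -> tangent_order k g.
Proof.
move=> GId Gf [fk [p hp fp]] [c Gc] g Gg g1.
have [l gl] := exists_tangent_order (GId _ Gg) g1.
have [<- //|/eqP nlk] := eqVneq l k; exfalso.
have [k0 _ _ [i0 fi0]] := fk.
have p0 : (p != 0)%R.
  by apply/eqP => E; apply: fi0; rewrite fp E mul0r.
have ldf : leading k f (fun i => p * 'X_i)%R.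
  by move=> i; rewrite -fp; apply: tangent_order_leading.
(* Homogeneity and nonvanishing of [X] are carried along so that [bracket_euler_eq0] applies again
   at each step. *)
have : forall c, exists x l X, [/\ lower_central G c x, (0 < l)%N, l <> k,
    leading l x X & (forall i, X i \is l.+1.-homog for mdeg) /\ exists i, X i <> 0%R].
  elim=> [|d [x [e [X [Gx e0 nek lX [hX [i Xi]]]]]]].
    exists g, l, (fun i => fps_hpart l.+1 (g i)); have [l0 _ _ nz] := gl.
    by split=> //; [exact: tangent_order_leading|split=> // i; exact: hpart_homog].
  exists [~ x, f], (e + k)%N, (bracket X (fun j => p * 'X_j)%R); split.
  - exact: lower_central_commg.
  - by rewrite addn_gt0 e0.
  - by move/eqP; rewrite -[X in _ == X]add0n eqn_add2r -leqn0 leqNgt e0.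
  - exact: leading_commg.
  split=> [j|].
    apply: dhomog_bracket => // {}j; rewrite -addn1; apply: dhomogM => //.
    by rewrite dhomogX; apply/eqP/mdeg1.
  apply: contrapT => nB; apply: Xi; apply: (bracket_euler_eq0 e0 nek p0 hp hX) => j.
  by apply: contrapT => Bj; apply: nB; exists j.
move=> /(_ c)[x [e [X [Gx e0 _ lX [hX [i Xi]]]]]].
by apply: (leading_neq1 e0 lX (hX i) Xi); move: Gx; rewrite Gc.
Qed.

Lemma order_abelian (K : fieldType) (n k : nat) (G : set (fdiff K n)) :
  is_subgroup G ->
  (forall g, G g -> g <> 1 -> tangent_order k g) -> is_abelian G.
Proof.
move=> [_ GM GV] Gk x y Gx Gy.
have [->|/eqP x1] := eqVneq x 1; first by rewrite mul1g mulg1.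
have [->|/eqP y1] := eqVneq y 1; first by rewrite mul1g mulg1.
apply/commgP/eqP; apply: contrapT => c1.
have Gc : G [~ x, y] := GM _ _ (GV _ Gx) (GM _ _ (GV _ Gy) (GM _ _ Gx Gy)).
have xk := Gk _ Gx x1; have yk := Gk _ Gy y1.
(* The commutator would have a nonzero part of degree [k + 1], but its leading degree is at least
   [2k + 1], and [1 < k + 1 <= 2k]. *)
have [k0 _ _ [i []]] := Gk _ Gc c1.
have lc := leading_commg k0 k0 (tangent_order_leading xk) (tangent_order_leading yk).
apply: (leading_hpart0 i lc); lia.
Qed.

End MainArgument.

Local Open Scope classical_set_scope.
Local Open Scope group_scope.

Theorem theorem1p23 (R : realType) (n k : nat) (G : set (fdiff R[i] n)) :
  is_subgroup G ->
  G `<=` @Diff_Id R[i] n ->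
  (exists2 f, G f & dicritic k f) ->
  [<-> is_abelian G;
       is_nilpotent G;
       forall g, G g -> g <> 1 -> tangent_order k g].
Proof.
move=> sG GId [f Gf fk]; tfae.
- exact: abelian_nilpotent.
- exact: nilpotent_order GId Gf fk.
- exact: order_abelian.
Qed.
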